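(* Let $d\in\mathbb{N}$, $d\ge 1$. For every ReLU neural network $f\colon\mathbb{R}^d\to\mathbb{R}$, there exist finite nonempty index sets $\mathcal{I}=\{1,\dots,m\}\subseteq\mathbb{N}$ and $\mathcal{J}=\{1,\dots,n\}\subseteq\mathbb{N}$ and pairs $(a_{ij},b_{ij})\in\mathbb{R}^d\times\mathbb{R}$ for $i\in\mathcal{I}$, $j\in\mathcal{J}$, such that $$f(x)=\min_{i\in\mathcal{I}}\max_{j\in\mathcal{J}}\,(a_{ij}^\top x+b_{ij})\quad\text{for all }x\in\mathbb{R}^d.$$ Hence, the class $\mathcal{G}$ of min-max affine functions on $\mathbb{R}^d$ is dense in $C(\mathbb{R}^d,\mathbb{R})$ (the set of continuous functions from $\mathbb{R}^d$ into $\mathbb{R}$) with respect to the topology of uniform convergence on compact sets.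
   Context: A ReLU neural network on $\mathbb{R}^d$ is a function $f\colon\mathbb{R}^d\to\mathbb{R}$ of the form $f=\mathcal{A}_L\circ\sigma\circ\mathcal{A}_{L-1}\circ\sigma\circ\cdots\circ\sigma\circ\mathcal{A}_1$ for some $L\ge1$, where the $\mathcal{A}_l$ are affine maps between finite-dimensional real spaces of compatible (arbitrary) dimensions, the domain of $\mathcal{A}_1$ being $\mathbb{R}^d$ and the codomain of $\mathcal{A}_L$ being $\mathbb{R}$, and $\sigma$ is the elementwise application of $\mathrm{ReLU}\colon x\mapsto\max\{0,x\}$. A function $g\colon\mathbb{R}^d\to\mathbb{R}$ is a min-max affine function if there exist finite nonempty index sets $\mathcal{I}=\{1,\dots,m\}$ and $\mathcal{J}_1,\dots,\mathcal{J}_{m}\subseteq\mathbb{N}$ and associated $a_{ij}\in\mathbb{R}^d$, $b_{ij}\in\mathbb{R}$ such that $g(x)=\min_{i\in\mathcal{I}}\max_{j\in\mathcal{J}_i}(a_{ij}^\top x+b_{ij})$ for all $x\in\mathbb{R}^d$. The class of all such functions is denoted by $\mathcal{G}$. *)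

(* Defs.v *)
(* MathComp-Analysis; vectors of R^n are the columns 'cV[R]_n. *)
From mathcomp Require Import all_boot all_order all_algebra finmap.
From mathcomp Require Import all_classical all_reals all_analysis.

Set Implicit Arguments.
Unset Strict Implicit.
Unset Printing Implicit Defensive.

Import Order.TTheory GRing.Theory Num.Theory.
Import numFieldNormedType.Exports.

Local Open Scope classical_set_scope.
Local Open Scope ring_scope.

Definition affine_map (R : realType) (U V : lmodType R) (A : U -> V) : Prop :=
  exists (h : {linear U -> V}) (c : V), forall x, A x = h x + c.

Definition relu (R : realType) (x : R) : R := Num.max 0 x.

(* f = A_L \o sigma \o ... \o sigma \o A_1, built from the output side; the
   number of layers and the widths of the hidden layers are arbitrary. *)
Inductive relu_network (R : realType) : forall n, ('cV[R]_n -> R^o) -> Prop :=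
| relu_network_affine n (A : 'cV[R]_n -> R^o) :
    affine_map A -> relu_network A
| relu_network_layer n p (A : 'cV[R]_n -> 'cV[R]_p) (f : 'cV[R]_p -> R^o) :
    affine_map A -> relu_network f ->
    relu_network (f \o map_mx (@relu R) \o A).

Definition affine_form (R : realType) (d : nat) (a : 'cV[R]_d) (b : R)
  (x : 'cV[R]_d) : R := (a^T *m x) 0 0 + b.

(* Finite minima and maxima are taken in \bar R, where the neutral elements +oo
   and -oo exist; over nonempty index sets they are the ones of R. *)
Definition minmax_affine (R : realType) (d : nat) (g : 'cV[R]_d -> R) : Prop :=
  exists (m : nat) (J : 'I_m -> {fset nat})
         (a : 'I_m -> nat -> 'cV[R]_d) (b : 'I_m -> nat -> R),
    [/\ (0 < m)%N, (forall i, J i != fset0) &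
      forall x, (g x)%:E =
        \big[Order.min/+oo%E]_(i < m) \big[Order.max/-oo%E]_(j <- J i)
          (affine_form (a i j) (b i j) x)%:E].

(* C(R^d, R), with the topology of uniform convergence on compact sets, i.e. the
   one induced by that of {family compact, R^d -> R}. *)
Definition ctsfun_compact_cvg (R : realType) (d : nat) :=
  initial_topology
    (id : continuousType 'cV[R]_d R -> {family compact, 'cV[R]_d -> R}).

(* Main.v *)
Require Import Defs.
From HB Require Import structures.
From mathcomp Require Import all_boot all_order all_algebra finmap.
From mathcomp Require Import all_classical all_reals all_analysis.

Set Implicit Arguments.
Unset Strict Implicit.
Unset Printing Implicit Defensive.

Import Order.TTheory GRing.Theory Num.Theory.
Import numFieldNormedType.Exports.

Local Open Scope classical_set_scope.
Local Open Scope ring_scope.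

(* Both claims go through the lattice generated by affine forms. It is closed
   under linear combinations, hence under precomposition with maps having all
   coordinates in it, so it contains every ReLU network by induction on the
   layers; distributivity puts each of its members in min-max form. Density is
   the lattice version of the Stone-Weierstrass theorem: affine forms take
   prescribed values at any two points, and on a compact set a finite minimum,
   then a finite maximum, of such interpolants is within [e] of the target. *)
Inductive affine_lattice (R : realType) (d : nat) : ('cV[R]_d -> R) -> Prop :=
| affine_lattice_form a b : affine_lattice (affine_form a b)
| affine_lattice_min f g :
    affine_lattice f -> affine_lattice g -> affine_lattice (f \min g)
| affine_lattice_max f g :
    affine_lattice f -> affine_lattice g -> affine_lattice (f \max g).

(** * Closure properties of the lattice of affine forms *)

Section AffineLattice.
Variables (R : realType) (d : nat).
Implicit Types (f g : 'cV[R]_d -> R) (a x : 'cV[R]_d) (b c : R).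

Lemma affine_formD a1 a2 b1 b2 x :
  affine_form (a1 + a2) (b1 + b2) x = affine_form a1 b1 x + affine_form a2 b2 x.
Proof. by rewrite /affine_form linearD mulmxDl mxE addrACA. Qed.

Lemma affine_formZ c a b x :
  affine_form (c *: a) (c * b) x = c * affine_form a b x.
Proof. by rewrite /affine_form linearZ /= -scalemxAl mxE mulrDr. Qed.

Lemma affine_form_delta k c b x :
  affine_form (c *: delta_mx k 0) b x = c * x k 0 + b.
Proof.
rewrite /affine_form linearZ /= -scalemxAl mxE trmx_delta mxE (bigD1 k) //=.
rewrite mxE !eqxx mul1r big1 ?addr0 // => i nik.
by rewrite mxE (negPf nik) andbF mul0r.
Qed.

Lemma affine_lattice_cst c : affine_lattice (fun _ : 'cV[R]_d => c).
Proof.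
rewrite (_ : (fun _ => c) = affine_form 0 c); first exact: affine_lattice_form.
by apply/funext => x; rewrite /affine_form trmx0 mul0mx mxE add0r.
Qed.

(** Addition distributes over [\min] and [\max]: induction on [f] reduces to affine [f], then
    induction on [g] to a sum of two affine forms. *)
Lemma affine_latticeD f g : affine_lattice f -> affine_lattice g ->
  affine_lattice (fun x => f x + g x).
Proof.
move=> + lg; elim=> {f} [a b|f1 f2 _ IH1 _ IH2|f1 f2 _ IH1 _ IH2].
- elim: lg => {g} [a' b'|g1 g2 _ IH1 _ IH2|g1 g2 _ IH1 _ IH2].
  + rewrite (_ : (fun _ => _) = affine_form (a + a') (b + b')).
      exact: affine_lattice_form.
    by apply/funext => x; rewrite affine_formD.
  + rewrite (_ : (fun _ => _) = (fun x => affine_form a b x + g1 x) \min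
       (fun x => affine_form a b x + g2 x)); first exact: affine_lattice_min.
    by apply/funext => x /=; rewrite addr_minr.
  + rewrite (_ : (fun _ => _) = (fun x => affine_form a b x + g1 x) \max
       (fun x => affine_form a b x + g2 x)); first exact: affine_lattice_max.
    by apply/funext => x /=; rewrite addr_maxr.
- rewrite (_ : (fun _ => _) = (fun x => f1 x + g x) \min (fun x => f2 x + g x)).
    exact: affine_lattice_min.
  by apply/funext => x /=; rewrite addr_minl.
- rewrite (_ : (fun _ => _) = (fun x => f1 x + g x) \max (fun x => f2 x + g x)).
    exact: affine_lattice_max.
  by apply/funext => x /=; rewrite addr_maxl.
Qed.

(** A negative scalar exchanges minima and maxima, so both operations must be available at once. *)
Lemma affine_latticeZ c f :
  affine_lattice f -> affine_lattice (fun x => c * f x).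
Proof.
elim=> {f} [a b|f1 f2 _ IH1 _ IH2|f1 f2 _ IH1 _ IH2].
- rewrite (_ : (fun _ => _) = affine_form (c *: a) (c * b)).
    exact: affine_lattice_form.
  by apply/funext => x; rewrite affine_formZ.
- have [c0|/ltW c0] := leP 0 c.
    rewrite (_ : (fun _ => _) = (fun x => c * f1 x) \min (fun x => c * f2 x)).
      exact: affine_lattice_min.
    by apply/funext => x /=; rewrite minr_pMr.
  rewrite (_ : (fun _ => _) = (fun x => c * f1 x) \max (fun x => c * f2 x)).
    exact: affine_lattice_max.
  by apply/funext => x /=; rewrite minr_nMr.
- have [c0|/ltW c0] := leP 0 c.
    rewrite (_ : (fun _ => _) = (fun x => c * f1 x) \max (fun x => c * f2 x)).
      exact: affine_lattice_max.
    by apply/funext => x /=; rewrite maxr_pMr.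
  rewrite (_ : (fun _ => _) = (fun x => c * f1 x) \min (fun x => c * f2 x)).
    exact: affine_lattice_min.
  by apply/funext => x /=; rewrite maxr_nMr.
Qed.

Lemma affine_lattice_sum (I : Type) (r : seq I) (F : I -> 'cV[R]_d -> R) :
  (forall i, affine_lattice (F i)) ->
  affine_lattice (fun x => \sum_(i <- r) F i x).
Proof.
move=> lF; elim: r => [|i r IH].
  rewrite (_ : (fun _ => _) = (fun=> 0)); first exact: affine_lattice_cst.
  by apply/funext => x; rewrite big_nil.
rewrite (_ : (fun _ => _) = (fun x => F i x + \sum_(j <- r) F j x)).
  exact: affine_latticeD.
by apply/funext => x; rewrite big_cons.
Qed.

(** Precomposition commutes with [\min] and [\max]; an affine form of [h] is a linear combination of
    the coordinates of [h] plus a constant. *)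
Lemma affine_lattice_comp p (f : 'cV[R]_p -> R) (h : 'cV[R]_d -> 'cV[R]_p) :
  affine_lattice f -> (forall k, affine_lattice (fun x => h x k 0)) ->
  affine_lattice (f \o h).
Proof.
move=> lf lh; elim: lf => {f} [a b|f1 f2 _ IH1 _ IH2|f1 f2 _ IH1 _ IH2].
- rewrite (_ : _ \o h = (fun x => \sum_k a k 0 * h x k 0 + b)).
    apply: affine_latticeD (affine_lattice_cst b).
    apply: affine_lattice_sum => k; exact: affine_latticeZ.
  apply/funext => x; rewrite /= /affine_form mxE; congr (_ + _).
  by apply: eq_bigr => k _; rewrite mxE.
- exact: (affine_lattice_min IH1 IH2).
- exact: (affine_lattice_max IH1 IH2).
Qed.

(** The coefficients are the values on the standard basis. Linearity is a predicate here so that it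
    can be supplied for a coordinate of a linear map. *)
Lemma affine_lattice_linear (h : 'cV[R]_d -> R^o) :
  linear h -> affine_lattice h.
Proof.
move=> lin_h; pose hL := GRing.isLinear.Build _ _ _ _ _ lin_h.
pose H : {linear 'cV[R]_d -> R^o} := HB.pack h hL.
rewrite (_ : h = affine_form (\col_k H (delta_mx k 0)) 0).
  exact: affine_lattice_form.
apply/funext => x; rewrite -[h x]/(H x) {1}(matrix_sum_delta x) linear_sum.
rewrite /affine_form addr0 mxE; apply: eq_bigr => k _.
by rewrite big_ord1 linearZ !mxE; exact: mulrC.
Qed.

End AffineLattice.

(** * ReLU networks and min-max normal forms *)

Lemma relu_network_affine_lattice (R : realType) (d : nat)
    (f : 'cV[R]_d -> R^o) :
  relu_network f -> affine_lattice f.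
Proof.
elim=> {d f} [n A [h [c hE]]|n p A f [h [c hE]] _ lf].
  rewrite (_ : A = fun x => h x + c); last exact/funext.
  apply: (@affine_latticeD _ _ h (fun=> c)) (affine_lattice_cst _ _).
  by apply: affine_lattice_linear; exact: linearP.
(* Each coordinate of the activated layer is the maximum of the constant [0] and an affine
   function. *)
rewrite -compA; apply: affine_lattice_comp lf _ => k.
have lA : affine_lattice (fun x : 'cV[R]_n => h x k 0 + c k 0).
  apply: (@affine_latticeD R n (fun x => h x k 0) (fun=> c k 0)).
    by apply: affine_lattice_linear => e x y; rewrite linearP !mxE.
  exact: affine_lattice_cst.
have := affine_lattice_max (affine_lattice_cst n 0) lA.
congr (affine_lattice _).
by apply/funext => x; rewrite /= mxE /relu hE mxE.
Qed.

(* [f = min_i max_j], stated by inequalities so as to avoid the neutral elements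
   of [min] and [max]; the index types are nonempty as a consequence. *)
Lemma affine_lattice_fin (R : realType) (d : nat) (f : 'cV[R]_d -> R) :
  affine_lattice f ->
  exists (I J : finType) (a : I -> J -> 'cV[R]_d) (b : I -> J -> R),
    forall x, (forall i, exists j, f x <= affine_form (a i j) (b i j) x) /\
              (exists i, forall j, affine_form (a i j) (b i j) x <= f x).
Proof.
elim=> {f} [a b|f1 f2 _ [I1 [J1 [a1 [b1 H1]]]] _ [I2 [J2 [a2 [b2 H2]]]]
               |f1 f2 _ [I1 [J1 [a1 [b1 H1]]]] _ [I2 [J2 [a2 [b2 H2]]]]].
- exists unit, unit, (fun _ _ => a), (fun _ _ => b) => x.
  by split => [_|]; exists tt.
(* The rows of both families are put together. The product gives all rows the same columns, each row
   ignoring one component; [j1] and [j2] fill the ignored one. *)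
- exists (I1 + I2)%type, (J1 * J2)%type,
    (fun i j => match i with inl i => a1 i j.1 | inr i => a2 i j.2 end),
    (fun i j => match i with inl i => b1 i j.1 | inr i => b2 i j.2 end) => x.
  have [[ge1 [i1 le1]] [ge2 [i2 le2]]] := (H1 x, H2 x).
  have [[j1 _] [j2 _]] := (ge1 i1, ge2 i2).
  split => [[i|i]|] /=.
  + by have [j hj] := ge1 i; exists (j, j2); rewrite ge_min hj.
  + by have [j hj] := ge2 i; exists (j1, j); rewrite ge_min hj orbT.
  + have [f12|f21] := leP (f1 x) (f2 x).
    * by exists (inl i1) => j; exact: le1.
    * by exists (inr i2) => j; exact: le2.
(* Distributivity: the maximum of two minima is the minimum, over pairs of rows, of the larger of
   the two row maxima. *)
- exists (I1 * I2)%type, (J1 + J2)%type,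
    (fun i j => match j with inl j => a1 i.1 j | inr j => a2 i.2 j end),
    (fun i j => match j with inl j => b1 i.1 j | inr j => b2 i.2 j end) => x.
  have [[ge1 [i1 le1]] [ge2 [i2 le2]]] := (H1 x, H2 x).
  split => [[i k]|] /=.
  + have [f12|f21] := leP (f1 x) (f2 x).
    * by have [j hj] := ge2 k; exists (inr j).
    * by have [j hj] := ge1 i; exists (inl j).
  + by exists (i1, i2) => -[j|j]; rewrite le_max /= ?le1 ?le2 ?orbT.
Qed.

Lemma affine_lattice_minmax (R : realType) (d : nat) (f : 'cV[R]_d -> R) :
  affine_lattice f ->
  exists (m n : nat) (a : 'I_m -> 'I_n -> 'cV[R]_d) (b : 'I_m -> 'I_n -> R),
    [/\ (0 < m)%N, (0 < n)%N &
      forall x, (f x)%:E =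
        \big[Order.min/+oo%E]_(i < m) \big[Order.max/-oo%E]_(j < n)
          (affine_form (a i j) (b i j) x)%:E].
Proof.
move=> /affine_lattice_fin [I [J [a [b H]]]].
exists #|I|, #|J|, (fun i j => a (enum_val i) (enum_val j)),
  (fun i j => b (enum_val i) (enum_val j)).
(* Evaluation at the origin yields an inhabitant of each index type, hence positive cardinals. *)
have [ge0 [i0 _]] := H 0; have [j0 _] := ge0 i0.
split=> [||x]; [by apply/card_gt0P; exists i0|by apply/card_gt0P; exists j0|].
have [gex [i lei]] := H x.
apply/eqP; rewrite eq_le; apply/andP; split.
  apply: le_bigmin => [|k _]; first exact: leey.
  have [j hj] := gex (enum_val k).
  by apply: (bigmax_sup (enum_rank j)) => //; rewrite enum_rankK lee_fin.
apply: (bigmin_inf (enum_rank i)) => //.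
by apply: bigmax_le => [|k _]; rewrite ?leNye // enum_rankK lee_fin.
Qed.

Lemma affine_lattice_minmax_affine (R : realType) (d : nat)
    (f : 'cV[R]_d -> R) :
  affine_lattice f -> minmax_affine f.
Proof.
move=> /affine_lattice_minmax [m [[|n] [a [b [m0 // _ fE]]]]].
(* All rows share the index set of the naturals from [0] to [n], read back as ordinals by
   [inord]. *)
exists m, (fun=> seq_fset tt (iota 0 n.+1)), (fun i j => a i (inord j)),
  (fun i j => b i (inord j)); split=> // [i|x].
  by apply/fset0Pn; exists 0%N; rewrite seq_fsetE.
rewrite fE; apply: eq_bigr => i _.
rewrite (perm_big _ (seq_fset_perm _ _)) undup_id ?iota_uniq //.
by rewrite -/(index_iota 0 n.+1) big_mkord; apply: eq_bigr => j _; rewrite inord_val.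
Qed.

(** * From min-max affine functions back to the lattice *)

Lemma affine_lattice_bigmin (R : realType) (d : nat) (I : Type) (r : seq I)
    (F : I -> 'cV[R]_d -> \bar R) :
  r <> [::] ->
  (forall i, exists2 h, affine_lattice h & forall x, F i x = (h x)%:E) ->
  exists2 h, affine_lattice h &
    forall x, \big[Order.min/+oo%E]_(i <- r) F i x = (h x)%:E.
Proof.
(* The induction starts from one-element lists, since the empty minimum is [+oo] and not a real
   value. *)
move=> + lF; case: r => // i r _; elim: r i => [|j r IH] i.
  by have [h lh hE] := lF i; exists h => // x; rewrite big_seq1.
have [[h lh hE] [g lg gE]] := (lF i, IH j).
exists (h \min g); first exact: affine_lattice_min.
by move=> x; rewrite big_cons hE gE EFin_min.
Qed.

Lemma affine_lattice_bigmax (R : realType) (d : nat) (I : Type) (r : seq I)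
    (F : I -> 'cV[R]_d -> \bar R) :
  r <> [::] ->
  (forall i, exists2 h, affine_lattice h & forall x, F i x = (h x)%:E) ->
  exists2 h, affine_lattice h &
    forall x, \big[Order.max/-oo%E]_(i <- r) F i x = (h x)%:E.
Proof.
move=> + lF; case: r => // i r _; elim: r i => [|j r IH] i.
  by have [h lh hE] := lF i; exists h => // x; rewrite big_seq1.
have [[h lh hE] [g lg gE]] := (lF i, IH j).
exists (h \max g); first exact: affine_lattice_max.
by move=> x; rewrite big_cons hE gE EFin_max.
Qed.

(** Brings the continuity of lattice functions to all min-max affine functions. *)
Lemma minmax_affine_lattice (R : realType) (d : nat) (f : 'cV[R]_d -> R) :
  minmax_affine f -> affine_lattice f.
Proof.
move=> [[|m] [J [a [b [// _ J0 fE]]]]].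
have [||h lh hE] := @affine_lattice_bigmin R d _ (index_enum 'I_m.+1)
  (fun i x => \big[Order.max/-oo%E]_(j <- J i)
    (affine_form (a i j) (b i j) x)%:E).
- by move=> r0; have := mem_index_enum (@ord0 m); rewrite r0.
- move=> i; apply: affine_lattice_bigmax => [Ji0|j].
    by have /fset0Pn[j] := J0 i; rewrite -[_ \in _]/(_ \in (J i : seq _)) Ji0.
  by exists (affine_form (a i j) (b i j)) => //; exact: affine_lattice_form.
- by rewrite (_ : f = h) //; apply/funext => x; apply: EFin_inj; rewrite fE hE.
Qed.

(** * Continuity and uniform approximation on compact sets *)

Lemma affine_lattice_continuous (R : realType) (d : nat) (f : 'cV[R]_d -> R) :
  affine_lattice f -> continuous f.
Proof.
elim=> {f} [a b|f1 f2 _ IH1 _ IH2|f1 f2 _ IH1 _ IH2] x.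
- rewrite (_ : affine_form a b =
               (fun x => \sum_k (a k 0 * x k 0 : R^o)) + cst (b : R^o)).
    apply: (@continuousD R R^o); last exact: cst_continuous.
    apply: (@continuous_big R^o _ +%R 0 predT add_continuous) => k _ y.
    apply: (@continuousM R _ (cst (a k 0))); first exact: cst_continuous.
    exact: coord_continuous.
  apply/funext => y; rewrite /affine_form mxE; congr (_ + _).
  by apply: eq_bigr => k _; rewrite mxE.
- exact: (continuous_min (IH1 x) (IH2 x)).
- exact: (continuous_max (IH1 x) (IH2 x)).
Qed.

(** Finite subcovers as an induction principle: below, [Q A] says that some lattice function
    satisfies a one-sided bound on [A], and [\min] or [\max] glues two of them. *)
Lemma compact_ind (T : ptopologicalType) (K : set T) (Q : set T -> Prop) :
  compact K -> Q set0 -> (forall A B, Q A -> Q B -> Q (A `|` B)) ->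
  (forall A B, A `<=` B -> Q B -> Q A) ->
  (forall x, K x -> exists U, [/\ open U, U x & Q U]) -> Q K.
Proof.
rewrite compact_cover => Kc Q0 QU Qsub Qloc.
have [||D QD KD] := Kc (set T) [set U | open U /\ Q U] id.
- by move=> U [].
- by move=> x /Qloc [U [oU Ux QU']]; exists U.
apply: Qsub KD _; rewrite /cover bigcup_fset big_seq.
by elim/big_ind : _ => // U /QD; rewrite inE => -[].
Qed.

(** Distinct points differ in some coordinate [k], and an affine function of it suffices; for equal
    points the hypothesis allows a constant. *)
Lemma affine_lattice_interp (R : realType) (d : nat) (x y : 'cV[R]_d)
    (s t : R) :
  (x = y -> s = t) ->
  exists h, [/\ affine_lattice h, h x = s & h y = t].
Proof.
have [<- /(_ erefl) <-|/eqP nxy _] := pselect (x = y).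
  by exists (fun=> s); split => //; exact: affine_lattice_cst.
have /existsP[k nk] : [exists k, x k 0 != y k 0].
  apply: contraNT nxy => /existsPn H; apply/eqP/matrixP => k j.
  by rewrite ord1; apply/eqP; move: (H k); rewrite negbK.
pose c := (t - s) / (y k 0 - x k 0).
exists (affine_form (c *: delta_mx k 0) (s - c * x k 0)).
split; first exact: affine_lattice_form.
- by rewrite affine_form_delta addrC subrK.
- rewrite affine_form_delta addrCA -mulrBr divfK ?subr_eq0 1?eq_sym //.
  by rewrite addrC subrK.
Qed.

Section Approximation.
Variables (R : realType) (d : nat) (K : set 'cV[R]_d).
Variables (f : 'cV[R]_d -> R) (e : R).
Hypotheses (cK : compact K) (cf : continuous f) (e0 : 0 < e).

(** By continuity, the interpolant of [f] at [x] and [y] stays below [f + e] near [y]; finite minima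
    keep this bound and the value at [x]. *)
Lemma affine_lattice_approx_above x :
  exists h, [/\ affine_lattice h, h x = f x & forall z, K z -> h z < f z + e].
Proof.
apply: (@compact_ind _ K (fun A => exists h, [/\ affine_lattice h, h x = f x &
  forall z, A z -> h z < f z + e])) => //.
- by exists (fun=> f x); split => //; exact: affine_lattice_cst.
- move=> A B [h [lh hx hA]] [g [lg gx gB]]; exists (h \min g); split.
  + exact: affine_lattice_min.
  + by rewrite /= hx gx minxx.
  + by move=> z [/hA|/gB] /= lt; rewrite gt_min lt ?orbT.
- by move=> A B AB [h [lh hx hB]]; exists h; split => // z /AB /hB.
- move=> y Ky.
  have [|h [lh hx hy]] := @affine_lattice_interp _ _ x y (f x) (f y).
    by move=> ->.
  exists [set z | h z - f z < e]; split.
  + apply: (@open_comp _ _ (fun z => h z - f z) [set r : R | r < e]).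
      move=> z _; apply: (@continuousB R R^o _ h f); last exact: cf.
      exact: affine_lattice_continuous.
    exact: open_lt.
  + by rewrite /= hy subrr.
  + by exists h; split => // z /=; rewrite ltrBlDl.
Qed.

Lemma affine_lattice_approx :
  exists h, affine_lattice h /\ forall z, K z -> `|f z - h z| < e.
Proof.
suff [h [lh ltK gtK]] : exists h, [/\ affine_lattice h,
    forall z, K z -> h z < f z + e & forall z, K z -> f z - e < h z].
  exists h; split=> // z Kz; rewrite distrC ltr_distl gtK //=; exact: ltK.
(* Only the lower bound is localised on [A]; the upper one is kept on all of [K], so it survives the
   maxima. *)
apply: (@compact_ind _ K (fun A => exists h, [/\ affine_lattice h,
  forall z, K z -> h z < f z + e & forall z, A z -> f z - e < h z])) => //.
(* On the empty set any lattice function below [f + e] on [K] will do; the base point [0] need not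
   lie in [K]. *)
- by have [h [lh _ hK]] := affine_lattice_approx_above 0; exists h; split.
- move=> A B [h [lh hK hA]] [g [lg gK gB]]; exists (h \max g); split.
  + exact: affine_lattice_max.
  + by move=> z Kz; rewrite /= gt_max hK ?gK.
  + by move=> z [/hA|/gB] /= lt; rewrite lt_max lt ?orbT.
- by move=> A B AB [h [lh hK hB]]; exists h; split => // z /AB /hB.
- move=> x Kx.
  have [h [lh hx hK]] := affine_lattice_approx_above x.
  exists [set z | f z - h z < e]; split.
  + apply: (@open_comp _ _ (fun z => f z - h z) [set r : R | r < e]).
      move=> z _; apply: (@continuousB R R^o _ f h); first exact: cf.
      exact: affine_lattice_continuous.
    exact: open_lt.
  + by rewrite /= hx subrr.
  + by exists h; split => // z /=; rewrite ltrBlDl -ltrBlDr.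
Qed.

End Approximation.

(** * Density for uniform convergence on compact sets *)

Lemma affine_lattice_dense (R : realType) (d : nat) :
  @dense (ctsfun_compact_cvg R d)
    [set g | affine_lattice (g : continuousType 'cV[R]_d R)].
Proof.
(* An open set of the initial topology is the preimage of an open [V], so a lattice function in [V]
   is sought. *)
move=> O [g Og] [V oV VO]; have Vg : V g by move: Og; rewrite -VO.
(* The sets [B (K, e)] of lattice functions [e]-close to [g] on [K] generate a
   proper filter that converges to [g]. *)
pose B (p : set 'cV[R]_d * R) := [set h : 'cV[R]_d -> R |
  affine_lattice h /\ forall z, p.1 z -> `|(g : 'cV[R]_d -> R) z - h z| < p.2].
pose F := filter_from [set p : set 'cV[R]_d * R | compact p.1 /\ 0 < p.2] B.
have FF : Filter F.
  apply: filter_from_filter.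
    by exists (set0, 1); split => //; exact: compact0.
  move=> [K1 e1] [K2 e2] /= [cK1 e10] [cK2 e20].
  exists (K1 `|` K2, Num.min e1 e2).
    by split; [exact: compactU|rewrite lt_min e10].
  by move=> h [lh hK]; split; split => // z Kz;
    have := hK z; rewrite lt_min => /(_ _) /andP[]; auto; [left|right].
have FP : ProperFilter F.
  (* Properness is the approximation result: every base set is inhabited. *)
  apply: filter_from_proper => -[K e] /= [cK e0].
  have [h ?] := affine_lattice_approx cK (@cts_fun _ _ g) e0.
  by exists h.
have Fg : F --> (g : {family compact, 'cV[R]_d -> R}).
  apply/fam_cvgP => K cK P /uniform_nbhs [E [entE EP]].
  move: entE; rewrite -entourage_ballE => -[e /= e0 eE].
  by exists (K, e) => // h [_ hK]; apply: EP => z Kz /=; exact/eE/hK.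
have : F (V `&` [set h | affine_lattice h]).
  apply: filterI; first by apply: Fg; exact: open_nbhs_nbhs.
  (* Every base set consists of lattice functions, so any index works. *)
  by exists (set0, 1) => [|h []//]; split => //; exact: compact0.
move=> /filter_ex [h [Vh lh]].
rewrite -VO.
(* [h] was found among all functions; its continuity makes it a point of the space of continuous
   functions. *)
by exists (mkcts (affine_lattice_continuous lh) : continuousType 'cV[R]_d R).
Qed.

Theorem theorem1 (R : realType) (d : nat) (hd : (0 < d)%N) :
  (forall f : 'cV[R]_d -> R, relu_network f ->
     exists (m n : nat) (a : 'I_m -> 'I_n -> 'cV[R]_d) (b : 'I_m -> 'I_n -> R),
       [/\ (0 < m)%N, (0 < n)%N &
         forall x, (f x)%:E =
           \big[Order.min/+oo%E]_(i < m) \big[Order.max/-oo%E]_(j < n)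
             (affine_form (a i j) (b i j) x)%:E])
  /\
  ((forall g : 'cV[R]_d -> R, minmax_affine g -> continuous g) /\
   @dense (ctsfun_compact_cvg R d)
     [set g | minmax_affine (g : continuousType 'cV[R]_d R)]).
Proof.
split; first by move=> f /relu_network_affine_lattice /affine_lattice_minmax.
split; first by move=> g /minmax_affine_lattice /affine_lattice_continuous.
move=> O O0 oO; have [g [Og lg]] := affine_lattice_dense O0 oO.
by exists g; split => //; exact: affine_lattice_minmax_affine.
Qed.
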